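(* For all $n\ge0$, $U_{n,1}=F_{n+1}$, where $(F_m)_{m\ge0}$ are the Fine numbers.
   Context: $U_{n,1}$ is the number of ascending (weakly increasing) $1$-Naples parking functions of length $n$ whose first entry is $1$, with the convention $U_{0,1}=0$. Parking rules: $n$ spots $1,\dots,n$; cars $c_1,\dots,c_n$ arrive in order with preferences $a_j\in[n]$; $1$-Naples rule: $c_j$ parks at $a_j$ if empty, otherwise parks at $a_j-1$ if that spot exists and is empty, otherwise drives forward from $a_j$ and parks in the first empty spot after $a_j$ (failing if none); a $1$-Naples parking function is a preference for which all cars park. The Fine numbers $F_m$ are defined by $\sum_{m\ge0}F_mx^m=\frac{1}{1-x^2C(x)^2}$, where $C(x)=\sum_{m\ge0}C_mx^m$ is the generating function of the Catalan numbers $C_m=\frac1{m+1}\binom{2m}{m}$ (so $F_0=1,F_1=0,F_2=1,F_3=2,\dots$; OEIS A000957). *)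

(* Defs.v *)
From HB Require Import structures.
From mathcomp Require Import all_boot all_order all_algebra.

Set Implicit Arguments.
Unset Strict Implicit.
Unset Printing Implicit Defensive.

Import GRing.Theory.

(* Spots are the natural numbers 1, ..., n; [occ] lists the occupied ones. *)
Definition naples1_spot (n : nat) (occ : seq nat) (a : nat) : option nat :=
  if a \notin occ then Some a
  else if (1 <= a.-1) && (a.-1 \notin occ) then Some a.-1
  else ohead [seq s <- iota a.+1 (n - a) | s \notin occ].

Fixpoint naples1_all_park (n : nat) (occ prefs : seq nat) : bool :=
  if prefs is a :: prefs' then
    if naples1_spot n occ a is Some s then naples1_all_park n (s :: occ) prefs'
    else false
  else true.

Definition naples1_parking_function (n : nat) (a : seq nat) : bool :=
  [&& size a == n, all (fun x => 1 <= x <= n) a & naples1_all_park n [::] a].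

(* The ambient type 'I_n.+1 only serves to make the set finite: entries are
   restricted to 1, ..., n by [naples1_parking_function].  The empty sequence
   has no first entry, so that U_{0,1} = 0 (lemma [U1_0]). *)
Definition U1 (n : nat) : nat :=
  #|[set t : n.-tuple 'I_n.+1 |
      let a := [seq val x | x <- t] in
      [&& naples1_parking_function n a, sorted leq a & ohead a == Some 1]]|.

Lemma U1_0 : U1 0 = 0.
Proof.
by apply/eqP; rewrite cards_eq0; apply/eqP/setP=> t; rewrite !inE tuple0 /= ?andbF.
Qed.

Local Open Scope ring_scope.

(* Formal power series over a field, given by their coefficient sequences. *)
Section FormalPowerSeries.
Variable R : fieldType.
Implicit Types f g : nat -> R.

Definition fps_one : nat -> R := fun m => (m == 0%N)%:R.
Definition fps_X : nat -> R := fun m => (m == 1%N)%:R.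
Definition fps_sub f g : nat -> R := fun m => f m - g m.
Definition fps_mul f g : nat -> R := fun m => \sum_(i < m.+1) f i * g (m - i)%N.

(* The coefficients of 1 / f up to degree m, when f 0%N is nonzero. *)
Fixpoint fps_inv_seq f (m : nat) : seq R :=
  if m is m'.+1 then
    let s := fps_inv_seq f m' in
    rcons s (- (f 0%N)^-1 * \sum_(i < m'.+1) f i.+1 * s`_(m' - i))
  else [:: (f 0%N)^-1].

Definition fps_inv f : nat -> R := fun m => (fps_inv_seq f m)`_m.

Lemma size_fps_inv_seq f m : size (fps_inv_seq f m) = m.+1.
Proof. by elim: m => //= m IHm; rewrite size_rcons IHm. Qed.

Lemma nth_fps_inv_seq f m i : (i <= m)%N -> (fps_inv_seq f m)`_i = fps_inv f i.
Proof.
elim: m => [|m IHm]; first by rewrite leqn0 => /eqP->.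
rewrite leq_eqVlt => /predU1P[->//|lt_im].
by rewrite /= nth_rcons size_fps_inv_seq lt_im IHm.
Qed.

Lemma fps_mulfV f : f 0%N != 0 -> fps_mul f (fps_inv f) =1 fps_one.
Proof.
move=> f0_neq0 [|m]; first by rewrite /fps_mul big_ord1 /= mulfV.
rewrite /fps_mul big_ord_recl subn0 {1}/fps_inv /= nth_rcons size_fps_inv_seq.
rewrite ltnn eqxx mulrA mulrN mulfV // mulN1r; apply/eqP.
rewrite addrC subr_eq0; apply/eqP/eq_bigr => i _.
by rewrite nth_fps_inv_seq ?leq_subr // /bump /= add1n subSS.
Qed.

Lemma fps_inv_unique f g :
  f 0%N != 0 -> fps_mul f g =1 fps_one -> g =1 fps_inv f.
Proof.
move=> f0_neq0 fg1 m; elim/ltn_ind: m => m IHm.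
have := fg1 m; rewrite -(fps_mulfV f0_neq0) /fps_mul !big_ord_recl subn0.
rewrite (eq_bigr (fun i => f (lift ord0 i) * fps_inv f (m - lift ord0 i)%N)).
  by move/addIr/(mulfI f0_neq0).
move=> i _; rewrite IHm // ltn_subrL lift0 /=.
exact: leq_ltn_trans (leq0n i) (ltn_ord i).
Qed.

End FormalPowerSeries.

Definition catalan : nat -> rat := fun m => 'C(2 * m, m)%:R / m.+1%:R.

Definition fine : nat -> rat :=
  let x := fps_X rat in
  fps_inv (fps_sub (fps_one rat)
                   (fps_mul (fps_mul x x) (fps_mul catalan catalan))).

Lemma fine_gf :
  fps_mul (fps_sub (fps_one rat)
             (fps_mul (fps_mul (fps_X rat) (fps_X rat))
                      (fps_mul catalan catalan))) fine =1 fps_one rat.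
Proof.
apply: fps_mulfV.
by rewrite /fps_sub /fps_mul !big_ord1.
Qed.

(* Main.v *)
(** An ascending 1-Naples parking function starting with 1 fills initial
    segments of the street: from 1, ..., M filled, either the next car takes
    spot M+1, or its preference is M+2 and the following car must prefer M+2 as
    well and back into M+1, any other choice leaving a spot that can no longer
    be filled.  Let G_d(x) be the generating series, by number of cars left, of
    the completions from last preference M-d.  Then
      G_d = 1 + x (G_0 + ... + G_(d+1)) + x^2 G_0,
    whence G_d = (1 + x^2 G_0) C^(d+2), because C^(k+1) = C^k + x C^(k+2).
    For d = 0 this says that 1 + x^2 G_0 = 1 / (1 - x^2 C^2). *)
Require Import Defs.
From mathcomp Require Import all_boot all_order all_algebra.
From mathcomp Require Import zify ring.

Set Implicit Arguments.
Unset Strict Implicit.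
Unset Printing Implicit Defensive.

Import GRing.Theory Num.Theory.

(** * Parking from a filled initial segment *)

Lemma naples1_spot_eqmem n occ1 occ2 a :
  occ1 =i occ2 -> naples1_spot n occ1 a = naples1_spot n occ2 a.
Proof.
move=> eq_occ; rewrite /naples1_spot !eq_occ.
by under eq_filter do rewrite eq_occ.
Qed.

Lemma naples1_all_park_eqmem n occ1 occ2 s :
  occ1 =i occ2 -> naples1_all_park n occ1 s = naples1_all_park n occ2 s.
Proof.
elim: s occ1 occ2 => //= a s IHs occ1 occ2 eq_occ.
rewrite (naples1_spot_eqmem n a eq_occ); case: naples1_spot => // t.
by apply: IHs => x; rewrite !inE eq_occ.
Qed.

Lemma naples1_spotP n occ a t : 1 <= a <= n -> naples1_spot n occ a = Some t ->
  [/\ t \notin occ, 1 <= t <= n & a.-1 <= t].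
Proof.
move=> a_in; rewrite /naples1_spot; case: ifP => [a_free [<-]|_].
  by split=> //; lia.
case: ifP => [/andP[a1 free] [<-]|_]; first by split=> //; lia.
case E: filter => [|x l] //= [eq_xt]; subst x.
have : t \in [seq s <- iota a.+1 (n - a) | s \notin occ] by rewrite E mem_head.
by rewrite mem_filter mem_iota => /andP[? ?]; split=> //; lia.
Qed.

(* Cars back up by at most one spot, so an empty spot [h] stays empty once all
   remaining preferences exceed [h.+1]. *)
Lemma unfillable_hole n occ s h :
    uniq occ -> all (fun x => 1 <= x <= n) occ -> h \notin occ -> 1 <= h <= n ->
    size occ + size s = n -> all (fun x => h.+2 <= x <= n) s ->
  naples1_all_park n occ s = false.
Proof.
move=> + + + h_in; elim: s occ => [|a s IHs] occ uocc occ_in h_free /=.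
  rewrite addn0 => size_occ _.
  have: size (h :: occ) <= size (iota 1 n).
    apply: uniq_leq_size; first by rewrite /= h_free.
    move=> x; rewrite inE mem_iota => /predU1P[->|/(allP occ_in)]; lia.
  by rewrite size_iota /= size_occ ltnn.
move=> size_occ /andP[a_in s_in]; case E: naples1_spot => [t|] //.
have [|t_free t_in le_at] := naples1_spotP _ E; first by lia.
apply: IHs => //=; rewrite ?t_free ?t_in //; last by lia.
by rewrite inE negb_or h_free andbT; lia.
Qed.

(* [fills M a s]: with spots 1, ..., M taken and last preference [a], the
   ascending preferences [s] fill a further initial segment.  Either the next
   car takes spot M+1, or two consecutive cars both prefer M+2, the second one
   backing into M+1. *)
Fixpoint fills (M a : nat) (s : seq nat) : bool :=
  if s is b :: s1 then
    if a <= b <= M.+1 then fills M.+1 b s1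
    else if b == M.+2 then
      if s1 is c :: s2 then (c == b) && fills M.+2 c s2 else false
    else false
  else true.

Lemma naples1_spot_next n M b : 1 <= b <= M.+1 -> M < n ->
  naples1_spot n (iota 1 M) b = Some M.+1.
Proof.
move=> b_in lt_Mn; rewrite /naples1_spot !mem_iota.
case: ifP => b_free; first by congr Some; lia.
rewrite ifF; last by lia.
(* Here [b <= M]: spots [b.+1] to [M] are taken, and [M.+1] heads the rest of the street. *)
have -> : n - b = (M - b) + (n - M).-1.+1 by lia.
rewrite iotaD filter_cat /=.
have -> : [seq s <- iota b.+1 (M - b) | s \notin iota 1 M] = [::].
  apply/eqP; rewrite -[_ == _]negbK -has_filter; apply/hasPn => x.
  by rewrite !mem_iota; lia.
by rewrite mem_iota ifT /=; [congr Some|]; lia.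
Qed.

(** Any choice rejected by [fills] breaks the order, leaves the street, or turns [M.+1] into an
    unfillable hole. The pair branch drops two cars, hence the induction on a bound for the
    length. *)
Lemma naples1_fills n M a s : 1 <= a <= M -> M + size s = n ->
  [&& path leq a s, all (fun x => 1 <= x <= n) s &
      naples1_all_park n (iota 1 M) s] = fills M a s.
Proof.
have [k] := ubnP (size s); elim: k => // k IHk in M a s *.
case: s => [|b s] //= lt_sk a_in size_s.
have path_all c t : path leq c t -> all (leq c) t.
  exact: order_path_min leq_trans.
case: ifP => [b_in|b_out].
  rewrite naples1_spot_next; [|lia..].
  rewrite -IHk; [|lia..].
  rewrite (@naples1_all_park_eqmem n (M.+1 :: iota 1 M) (iota 1 M.+1)) => [|x].
    have -> : a <= b by lia.
    by have -> : 0 < b <= n by lia.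
  by rewrite inE !mem_iota; lia.
have [lt_ba|le_ab] /= := ltnP b a; first by rewrite ifF //; lia.
case: (boolP (path leq b s)) => [/[dup] bs /path_all ge_b|bs] /=; last first.
  case: eqP => // eb; case: s bs lt_sk size_s => //= c s bs lt_sk size_s.
  have [ec|//] /= := eqVneq c b.
  rewrite -IHk; [|lia..]; move: bs; rewrite ec leqnn /=.
  by move/negPf->.
case: (boolP (all _ s)) => [s_in|s_out]; last first.
  rewrite andbF /=; case: eqP => // eb.
  case: s s_out lt_sk size_s {bs ge_b} => //= c s s_out lt_sk size_s.
  have [ec|//] /= := eqVneq c b.
  rewrite -IHk; [|lia..]; move: s_out.
  have -> : 0 < c <= n by lia.
  by rewrite /= => /negPf->; rewrite andbF.
have [eb|nb] := eqVneq b M.+2; last first.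
  apply/negbTE/negP => /andP[/andP[b_in _]].
  rewrite -/(naples1_all_park n (iota 1 M) (b :: s)).
  rewrite (@unfillable_hole _ _ _ M.+1) //.
  - exact: iota_uniq.
  - by apply/allP => x; rewrite mem_iota; lia.
  - by rewrite mem_iota; lia.
  - by lia.
  - by rewrite size_iota.
  apply/allP => x; rewrite inE => /predU1P[->|xs]; first by lia.
  by move/allP: ge_b => /(_ _ xs); move/allP: s_in => /(_ _ xs); lia.
rewrite /naples1_spot mem_iota ifT /=; last by lia.
(* A lone last car forces [n = M.+1], so its preference [M.+2] would be off the street. *)
case: s bs ge_b s_in lt_sk size_s => [|c s] //= bs ge_b s_in lt_sk size_s.
  by lia.
have [ec|nc] /= := eqVneq c b; last first.
  apply/negbTE/negP => /andP[/andP[b_in _]].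
  rewrite -/(naples1_all_park n (b :: iota 1 M) (c :: s)).
  rewrite (@unfillable_hole _ _ _ M.+1) //.
  - by rewrite /= iota_uniq mem_iota; lia.
  - by rewrite /= b_in; apply/allP => x; rewrite mem_iota; lia.
  - by rewrite inE mem_iota; lia.
  - by lia.
  - by rewrite /= size_iota; lia.
  case/andP: bs => le_bc /path_all ge_c.
  apply/allP => x; rewrite inE => /predU1P[->|xs]; first by lia.
  move/allP: ge_c => /(_ _ xs); case/andP: s_in => _ /allP/(_ _ xs); lia.
rewrite -IHk; [|lia..].
have -> : 0 < b <= n by lia.
move: bs s_in; rewrite ec => /andP[_ ->] /andP[_ ->] /=.
rewrite /naples1_spot !inE !mem_iota eqxx /= ifT; last by lia.
by apply: naples1_all_park_eqmem => x; rewrite !inE !mem_iota; lia.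
Qed.

(** * Counting words letter by letter *)

Fixpoint words_count (n m : nat) (P : seq nat -> bool) : nat :=
  if m is m'.+1 then \sum_(b < n) words_count n m' (fun s => P (val b :: s))
  else P [::].

Lemma eq_words_count n m (P Q : seq nat -> bool) :
  (forall s, size s = m -> P s = Q s) -> words_count n m P = words_count n m Q.
Proof.
elim: m P Q => [|m IHm] P Q eqPQ /=; first by rewrite eqPQ.
by apply: eq_bigr => b _; apply: IHm => s size_s; apply: eqPQ; rewrite /= size_s.
Qed.

Lemma words_count0 n m : words_count n m (fun=> false) = 0.
Proof. by elim: m => //= m IHm; rewrite big1. Qed.

Lemma card_words n m (P : seq nat -> bool) :
  #|[set t : m.-tuple 'I_n | P [seq val x | x <- t]]| = words_count n m P.
Proof.
rewrite -sum1dep_card big_mkcond /=; elim: m P => [|m IHm] P /=.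
  rewrite (big_pred1 [tuple]) => [|t]; first by case: (P _).
  by apply/esym/eqP; exact: tuple0.
pose cons_pair (p : 'I_n * m.-tuple 'I_n) := [tuple of p.1 :: p.2].
rewrite (reindex cons_pair) /=; last first.
  exists (fun t => (thead t, [tuple of behead t])) => [[b t]|t] _ /=.
    by rewrite theadE; congr pair; apply: val_inj.
  by rewrite [RHS]tuple_eta; apply: val_inj.
rewrite -(pair_big predT predT
  (fun b t => if P (val b :: [seq val x | x <- tval t]) then 1 else 0)) /=.
by apply: eq_bigr => b _; rewrite -IHm.
Qed.

(** The coefficient of x^r in G_d. The index [e] is the next distance [M.+1 - b]; the last summand
    counts the pairs preferring [M.+2], which reset the distance to 0. *)
Fixpoint fills_count (r d : nat) : nat :=
  if r is r1.+1 then
    \sum_(e < d.+2) fills_count r1 e + (if r1 is r2.+1 then fills_count r2 0 else 0)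
  else 1.

Lemma words_count_fills n M a r : a <= M -> M + r = n ->
  words_count n.+1 r (fills M a) = fills_count r (M - a).
Proof.
have [k] := ubnP r; elim: k => // k IHk in M a r *.
case: r => // r lt_rk le_aM size_r.
pose pairs := if r is r2.+1 then fills_count r2 0 else 0.
have term (b : 'I_n.+1) :
    words_count n.+1 r (fun s => fills M a (val b :: s)) =
    (if a <= b < M.+2 then fills_count r (M.+1 - b) else 0) +
    (if b == M.+2 :> nat then pairs else 0).
  rewrite /=; case: ifP => [b_in|b_out].
    by rewrite IHk ?ifF ?addn0 //; lia.
  case: eqP => [eb|_]; last by rewrite words_count0.
  rewrite add0n /pairs.
  case: r lt_rk size_r @pairs => [|r] //= lt_rk size_r.
  rewrite (bigD1 b) //= eqxx /= eb IHk ?subnn //; [|lia..].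
  rewrite big1 ?addn0 // => c ne_cb.
  have ne_cM : (c == M.+2 :> nat) = false by rewrite -eb; apply: negPf.
  by rewrite ne_cM words_count0.
rewrite /= (eq_bigr _ (fun b _ => term b)) big_split /=; congr (_ + _).
  rewrite -big_mkcond /= -(big_mkord (fun b => a <= b < M.+2)
     (fun b => fills_count r (M.+1 - b))).
  have -> : (M - a).+2 = M.+2 - a by lia.
  rewrite -[RHS](big_mkord xpredT (fills_count r)).
  rewrite (big_cat_nat (leq0n a)) /=; last by lia.
  rewrite big_nat_cond big1 ?add0n => [|i]; last by lia.
  rewrite (@big_cat_nat _ _ _ M.+2) /=; [|lia..].
  rewrite [X in _ + X]big_nat_cond [X in _ + X]big1 ?addn0 => [|i]; last by lia.
  (* The substitution [e = M.+1 - b] turns [a <= b < M.+2] into [e < M.+2 - a]. *)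
  rewrite -{1}[a]add0n big_addn big_nat_rev /= big_mkcond /= big_nat_cond.
  rewrite [RHS]big_nat_cond; apply: eq_bigr => i /andP[/andP[_ lt_i] _].
  by rewrite ifT; [congr fills_count|]; lia.
rewrite -big_mkcond /= /pairs; case: r lt_rk size_r {pairs term} => [|r] lt_rk size_r.
  by rewrite big1.
(* With at least two cars left, [M.+2] is a legal letter. *)
have lt_Mn : M.+2 < n.+1 by lia.
by rewrite (big_pred1 (Ordinal lt_Mn)).
Qed.

(** The first car takes spot 1, which leaves [M = a = 1]. *)
Lemma U1_fills_count n : U1 n.+1 = fills_count n 0.
Proof.
have := @words_count_fills n.+1 1 1 n isT (add1n n) => <-.
rewrite /U1 (card_words _ _ (fun a => [&& naples1_parking_function n.+1 a,
  sorted leq a & ohead a == Some 1])) /=.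
rewrite (bigD1 (inord 1)) //= big1 ?addn0 => [|b ne_b].
  apply: eq_words_count => s size_s; rewrite inordK //.
  rewrite -(@naples1_fills n.+1) ?size_s //=.
  rewrite /naples1_parking_function /= size_s eqxx /= /naples1_spot /=.
  by rewrite eqxx andbT andbC andbA.
rewrite -[RHS](words_count0 n.+2 n); apply: eq_words_count => s _.
rewrite [_ == Some 1](_ : _ = false) ?andbF //.
apply/negbTE; apply: contraNN ne_b => /eqP[eb]; apply/eqP/val_inj.
by rewrite /= inordK.
Qed.

(** * Powers of the Catalan series *)

Local Open Scope ring_scope.

(* C^(k+1) = C^k + x C^(k+2) on coefficients, with C^0 replaced by any series. *)
Definition catalan_tower (R : fieldType) (A : nat -> nat -> R) : Prop :=
  forall k, A k.+1 0%N = A k 0%N /\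
    forall r, A k.+1 r.+1 = A k r.+1 + A k.+2 r.

(** Passing from row k to row k+1 in degree r+1 only needs degree r of row k+2: induction on the
    degree, then on the row. *)
Lemma catalan_tower_inj (R : fieldType) (A B : nat -> nat -> R) :
  catalan_tower A -> catalan_tower B -> A 0%N =1 B 0%N -> forall k, A k =1 B k.
Proof.
move=> towA towB eq0 k r; elim: r k => [|r IHr]; elim=> [|k IHk] //.
  by rewrite (towA k).1 (towB k).1.
by rewrite (towA k).2 (towB k).2 IHk IHr.
Qed.

Lemma catalan_tower_fps_mul (R : fieldType) (f : nat -> R) A :
  catalan_tower A -> catalan_tower (fun k => fps_mul f (A k)).
Proof.
move=> towA k; split=> [|r]; rewrite /fps_mul.
  by rewrite !big_ord1 (towA k).1.
rewrite big_ord_recr [X in _ = X + _]big_ord_recr /= subnn (towA k).1.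
rewrite addrAC; congr (_ + _); rewrite -big_split; apply: eq_bigr => i _ /=.
by rewrite subSn -1?ltnS // (towA k).2 mulrDr.
Qed.

(* The coefficients of C^k by the reflection principle.  The truncated
   predecessor is harmless: at k = r = 0 it gives the constant term 1. *)
Definition catalan_pow (k r : nat) : rat :=
  'C((2 * r + k).-1, r)%:R -
  (if r is r'.+1 then 'C((2 * r + k).-1, r')%:R else 0).

Lemma catalan_tower_pow : catalan_tower catalan_pow.
Proof.
move=> k; split=> [|r]; rewrite /catalan_pow ?bin0 //.
have -> : ((2 * r.+1 + k.+1).-1 = (2 * r + k).+2)%N by lia.
have -> : ((2 * r.+1 + k).-1 = (2 * r + k).+1)%N by lia.
have -> : ((2 * r + k.+2).-1 = (2 * r + k).+1)%N by lia.
move: (2 * r + k).+1%N => m.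
by case: r => [|r]; rewrite !binS !natrD ?bin0; ring.
Qed.

Lemma catalan_pow0 : catalan_pow 0 =1 fps_one rat.
Proof.
case=> [|r]; rewrite /catalan_pow /fps_one /= ?subr0 //.
(* The two middle binomials of the odd row 2r+1 coincide. *)
apply/eqP; rewrite subr_eq0 -bin_sub; last by lia.
by apply/eqP; congr (_%:R); congr binomial; lia.
Qed.

Lemma fps_mul_pow0 f : fps_mul f (catalan_pow 0) =1 f.
Proof.
move=> r; rewrite /fps_mul big_ord_recr /= subnn catalan_pow0 mulr1.
rewrite big1 ?add0r // => i _.
by rewrite catalan_pow0 /fps_one subn_eq0 leqNgt ltn_ord mulr0.
Qed.

Lemma catalan_pow1 : catalan_pow 1 =1 catalan.
Proof.
move=> r; rewrite /catalan_pow /catalan addn1 /=.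
have r1_neq0 : r.+1%:R != 0 :> rat by rewrite pnatr_eq0.
apply: (mulIf r1_neq0); rewrite divfK //.
case: r {r1_neq0} => [|r]; first by rewrite bin0 subr0.
(* This reads (r+1) ['C(2r+2, r+1)] = (r+2) ['C(2r+2, r)], which removes the subtracted binomial. *)
have := mul_bin_left (2 * r.+1) r => /(congr1 (fun m => m%:R : rat)).
have -> : (2 * r.+1 - r = r.+2)%N by lia.
by rewrite !natrM mulrBl [_ * r.+2%:R in X in _ - X]mulrC => <-; ring.
Qed.

(** The towers C C^k and C^(k+1) agree at k = 0, hence at k = 1. *)
Lemma catalan_sqr : fps_mul catalan catalan =1 catalan_pow 2.
Proof.
have tow_shift : catalan_tower (fun k => catalan_pow k.+1).
  by move=> k; apply: catalan_tower_pow.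
have tow_mul := catalan_tower_fps_mul catalan catalan_tower_pow.
have eq0 : fps_mul catalan (catalan_pow 0) =1 catalan_pow 1.
  by move=> r; rewrite fps_mul_pow0 catalan_pow1.
move=> r; rewrite -(catalan_tower_inj tow_mul tow_shift eq0 1 r).
by apply: eq_bigr => i _; rewrite catalan_pow1.
Qed.

(** * Identification with the Fine numbers *)

Lemma fps_mul_sqrX (R : fieldType) (f : nat -> R) m :
  fps_mul (fps_mul (fps_X R) (fps_X R)) f m =
  if m is m'.+2 then f m' else 0.
Proof.
have sqrX i : fps_mul (fps_X R) (fps_X R) i = (i == 2)%:R.
  rewrite /fps_mul /fps_X; case: i => [|i].
    by rewrite big_ord1 mul0r.
  rewrite 2!big_ord_recl big1 => [|j _]; last by rewrite mul0r.
  by rewrite mul0r mul1r add0r addr0 /= subSS subn0.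
rewrite /fps_mul; under eq_bigr do rewrite -/(fps_mul _ _ _) sqrX.
case: m => [|[|m]]; rewrite ?big_ord_recl /= ?big_ord0 ?mul0r ?add0r //.
rewrite mul1r !subSS subn0 big1 ?addr0 // => i _.
by rewrite mul0r.
Qed.

(* A_0 = 1 + x^2 G_0, A_1 = A_0 + x G_0 and A_(d+2) = G_d, where G_d is the
   generating series of [fills_count ^~ d]. *)
Definition fills_tower (k r : nat) : rat :=
  let A0 r := (match r with 0 => 1 | 1 => 0 | r'.+2 => fills_count r' 0 end)%N in
  (match k with
   | 0 => A0 r
   | 1 => A0 r + (if r is r'.+1 then fills_count r' 0 else 0)
   | k'.+2 => fills_count r k'
   end)%N%:R.

(** Raising d by one adds the single term x G_(d+2) to the equation for G_d; the two lowest levels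
    are the definition of A_1 and the equation for G_0. *)
Lemma catalan_tower_fills : catalan_tower fills_tower.
Proof.
case=> [|[|k]]; split=> [|r] //; rewrite /fills_tower -?natrD //.
  congr (_%:R); rewrite /= !big_ord_recl big_ord0 addn0 -[RHS]addnA addnC.
  by case: r.
by congr (_%:R); rewrite /= big_ord_recr /= addnAC.
Qed.

(** The tower gives G_0 = A_0 C^2, so A_0 = 1 + x^2 G_0 is inverse to 1 - x^2 C^2. *)
Lemma fine_fills m : fine m = fills_tower 0 m.
Proof.
symmetry; move: m; rewrite /fine; set h := fps_sub _ _.
have hE i : h i = (i == 0)%:R - (if i is i'.+2 then catalan_pow 2 i' else 0).
  by rewrite /h /fps_sub fps_mul_sqrX; case: i => [|[|i]]; rewrite ?catalan_sqr.
apply: fps_inv_unique; first by rewrite hE subr0 oner_eq0.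
have G0 m : fills_tower 0 m.+2 = fps_mul (fills_tower 0) (catalan_pow 2) m.
  have tow := catalan_tower_fps_mul (fills_tower 0) catalan_tower_pow.
  rewrite -(catalan_tower_inj catalan_tower_fills tow _ 2) // => r.
  by rewrite fps_mul_pow0.
case=> [|[|m]]; rewrite /fps_mul.
- by rewrite big_ord1 hE subr0 mul1r.
- by rewrite !big_ord_recl big_ord0 !hE !subr0 [fills_tower 0 _]mulr0n mulr0.
rewrite 2!big_ord_recl !hE !subr0 mul1r mul0r add0r subn0 G0.
(* The convolution from [G0] has its factors in the opposite order; once it is reversed, the terms
   cancel pairwise. *)
rewrite /fps_mul [X in X + _](reindex_inj rev_ord_inj) -big_split big1 //= => i _.
rewrite hE !subSS sub0r /bump /=.
have -> : (m - (m - i) = i)%N by have := ltn_ord i; lia.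
by rewrite mulNr mulrC subrr.
Qed.

Theorem theorem5p4 (n : nat) : (U1 n)%:R = fine n.+1 :> rat.
Proof.
by rewrite fine_fills; case: n => [|n]; rewrite ?U1_0 ?U1_fills_count.
Qed.
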